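(* Let $\beta,\gamma$ be arbitrary (complex) numbers, and let $(a_n)_{n\ge0}$ be defined by \[ \sum_{n\ge0}a_nx^n = \frac{1}{1-\beta x+(\beta^2-\gamma)x^2-x^3}. \] Then $(a_n)$ is fixed by $\mathcal{L}^2$, i.e. $\mathcal{L}(\mathcal{L}(a_n))=(a_n)$. Moreover $a_0=1$, $a_1=\beta$, $a_2=\gamma$.
   Context: For a sequence $(a_n)_{n\ge0}$, $\mathcal{L}$ denotes the operator sending $(a_n)$ to $(a_n^2-a_{n-1}a_{n+1})_{n\ge0}$, with the convention that the term of index $-1$ is $0$. *)

(* Defs.v *)
From mathcomp Require Import all_boot all_order all_algebra.
Set Implicit Arguments.
Unset Strict Implicit.
Unset Printing Implicit Defensive.
Import GRing.Theory.
Local Open Scope ring_scope.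

(* A formal power series sum_n (s n) x^n is represented by its sequence of
   coefficients s : nat -> K. *)

Definition fps_of_poly (K : nzRingType) (p : {poly K}) : nat -> K :=
  fun n => p`_n.

Definition fps_mul (K : nzRingType) (s t : nat -> K) : nat -> K :=
  fun n => \sum_(i < n.+1) s i * t (n - i)%N.

(* s = 1 / t in K[[x]].  K[[x]] is a commutative ring, so a given t has at most
   one such s; one exists as soon as the constant term t 0 is a unit. *)
Definition fps_is_inverse (K : comNzRingType) (s t : nat -> K) : Prop :=
  fps_mul s t =1 fps_of_poly 1.

(* The [else]-branch 0 is the convention a_{-1} = 0. *)
Definition calL (K : nzRingType) (a : nat -> K) : nat -> K :=
  fun n => a n ^+ 2 - (if n is m.+1 then a m else 0) * a n.+1.

(* Main.v *)
Require Import Defs.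
From mathcomp Require Import all_boot all_order all_algebra.
From mathcomp Require Import reals complex.
From mathcomp Require Import ring zify.
Set Implicit Arguments.
Unset Strict Implicit.
Unset Printing Implicit Defensive.
Import GRing.Theory.
Local Open Scope ring_scope.
Local Open Scope complex_scope.

(** If [1 - p x + q x^2 - x^3 = (1 - u x)(1 - v x)(1 - w x)], then [uvw = 1] and
    the coefficients of its inverse are the complete homogeneous polynomials
    [h_n(u, v, w)].  By Jacobi-Trudi, [calL] turns [h_n] into the Schur function
    [s_(n,n)(u, v, w) = h_n(1/u, 1/v, 1/w)], i.e. it exchanges [p] and [q]; so
    applying it twice restores the sequence.  By the linear
    recurrence of order 3, the exchange amounts to a polynomial identity in [p],
    [q] and three consecutive terms, valid over any commutative ring. *)

(* The initial values are those given by the recurrence when the terms of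
   negative index are 0. *)
Definition homogeneous_recurrence (K : comNzRingType) (p q : K) (a : nat -> K) :=
  [/\ a 0%N = 1, a 1%N = p, a 2%N = p ^+ 2 - q
    & forall n, a n.+3 = p * a n.+2 - q * a n.+1 + a n].

Lemma homogeneous_recurrence_unique (K : comNzRingType) (p q : K) (a b : nat -> K) :
  homogeneous_recurrence p q a -> homogeneous_recurrence p q b -> a =1 b.
Proof.
move=> [a0 a1 a2 aS] [b0 b1 b2 bS] n.
suff [] : [/\ a n = b n, a n.+1 = b n.+1 & a n.+2 = b n.+2] by [].
elim: n => [|n [IH0 IH1 IH2]]; first by rewrite a0 a1 a2 b0 b1 b2.
by rewrite aS bS IH0 IH1 IH2.
Qed.

Lemma homogeneous_recurrence_calL (K : comNzRingType) (p q : K) (a : nat -> K) :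
  homogeneous_recurrence p q a -> homogeneous_recurrence q p (calL a).
Proof.
move=> [a0 a1 a2 aS]; rewrite /calL; split.
- by rewrite a0 /=; ring.
- by rewrite /= a0 a1 a2; ring.
- by rewrite /= aS a0 a1 a2; ring.
(* Index 0 is separate: there [calL] uses the convention that the term of index -1 is 0. Otherwise
   all reduces to [a n], [a n.+1], [a n.+2]. *)
- by case=> [|n] /=; rewrite !aS ?a0 ?a1 ?a2; ring.
Qed.

Lemma homogeneous_recurrence_inverse (K : comNzRingType) (p q : K) (a : nat -> K) :
  fps_is_inverse a (fps_of_poly (1 - p *: 'X + q *: 'X^2 - 'X^3)) ->
  homogeneous_recurrence p q a.
Proof.
rewrite /fps_is_inverse /fps_mul /fps_of_poly => ha.
set P := 1 - _ + _ - _ in ha.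
have coefP k :
    P`_k = (k == 0%N)%:R - p * (k == 1%N)%:R + q * (k == 2%N)%:R
      - (k == 3%N)%:R.
  by rewrite /P !coefE.
have a0 : a 0%N = 1.
  by have := ha 0%N; rewrite big_ord1 coefP coefE /= mulr1n => <-; ring.
have a1 : a 1%N = p.
  have := ha 1%N; rewrite !big_ord_recr big_ord0 /= !coefP coefE /= mulr0n a0 => E.
  (* [E] says that a coefficient of the product is 0; adding it to [p] leaves a ring identity. *)
  by rewrite -[p]addr0 -E; ring.
have a2 : a 2%N = p ^+ 2 - q.
  have := ha 2%N; rewrite !big_ord_recr big_ord0 /= !coefP coefE /= mulr0n a0 a1 => E.
  by rewrite -[RHS]addr0 -E; ring.
split=> // n; have := ha n.+3.
(* [P] has degree 3, so only the last four terms of the convolution survive. *)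
rewrite !big_ord_recr /= big1 => [|i _]; last first.
  have -> : (n.+3 - i = (n - i.+1).+4)%N by have := ltn_ord i; lia.
  by rewrite coefP /=; ring.
have -> : (n.+3 - n = 3)%N by lia.
have -> : (n.+3 - n.+1 = 2)%N by lia.
rewrite subSnn subnn !coefP coefE /= mulr0n => E.
by rewrite -[RHS]addr0 -E; ring.
Qed.

Theorem theorem4p1 (R : realType) (beta gamma : R[i]) (a : nat -> R[i])
    (ha : fps_is_inverse a
            (fps_of_poly (1 - beta *: 'X + (beta ^+ 2 - gamma) *: 'X^2 - 'X^3))) :
  calL (calL a) =1 a /\ [/\ a 0%N = 1, a 1%N = beta & a 2%N = gamma].
Proof.
have rec_a := homogeneous_recurrence_inverse ha.
split.
  apply: (homogeneous_recurrence_unique _ rec_a).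
  exact: homogeneous_recurrence_calL (homogeneous_recurrence_calL rec_a).
by have [-> -> -> _] := rec_a; split=> //; ring.
Qed.
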